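(* Let $l\ge1$ be fixed and let $Q_{n,k}=\sum_{j\ge0}Q_{n,k,j}$, where $Q_{n,k,j}$ is the flag Eulerian quasisymmetric function described in the context. For integers $n\ge1$ and $a,b\geq1$ such that $a+b=ln$, $$\sum_{i=0}^{n-1}h_{i}\,Q_{n-i,a-1}=\sum_{i=0}^{n-1}h_i\,Q_{n-i,b-1},$$ where $h_i$ denotes the complete homogeneous symmetric function of degree $i$ (with $h_0=1$).
   Context: Fix a positive integer $l$ and commuting indeterminates $x_1,x_2,\dots$. Let $\mathcal{B}$ be the alphabet consisting of the letters $u^m$ ($u\in\{1,2,\dots\}$, $m\in\{0,1,\dots,l-1\}$) and the barred letters $\overline{u^0}$ ($u\in\{1,2,\dots\}$). The letter $u^m$ is called $m$-colored; $\overline{u^0}$ is called $0$-colored. The absolute value of $u^m$ and of $\overline{u^0}$ is $u$, and the weight of each is $x_u$. A colored necklace is a circular word over $\mathcal{B}$ (letters placed clockwise on a circle, up to rotation) which is primitive (the linear word is not a concatenation of at least two copies of a proper subword) and satisfies: (1) every barred letter is followed (clockwise) by a letter of lesser or equal absolute value; (2) every $0$-colored unbarred letter is followed by a letter of greater or equal absolute value; (3) a necklace of length one is not a single barred letter. A colored ornament is a finite multiset of colored necklaces; its weight $\mathrm{wt}(R)$ is the product of the weights of its letters. For $n,k,j\ge0$, $Q_{n,k,j}$ is the sum of $\mathrm{wt}(R)$ over all colored ornaments $R$ with $n$ letters in total, exactly $j$ necklaces consisting of a single letter of the form $u^0$, and with $l\cdot(\#\text{barred letters})+\sum_{m=1}^{l-1}m\cdot(\#\text{letters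 of the form }u^m)=k$. (By Hyatt's colored ornament interpretation this coincides with the paper's definition of the flag Eulerian quasisymmetric functions.) *)

(* Defs.v *)
From HB Require Import structures.
From mathcomp Require Import all_boot all_order all_algebra.
From mathcomp Require Import finmap mpoly.
Set Implicit Arguments. Unset Strict Implicit. Unset Printing Implicit Defensive.
Import GRing.Theory.
Local Open Scope ring_scope.

(* Symmetric/quasisymmetric functions in x_1, x_2, ... are handled through
   their restrictions to the finitely many variables x_1..x_N (variable x_(u+1)
   is 'X_u for u : 'I_N), for every N.  Coefficients in int. *)

Definition hsym (N i : nat) : {mpoly int[N]} :=
  \sum_(m : 'X_{1..N < i.+1} | mdeg m == i) 'X_[val m].

(* A letter with absolute value <= N: (u, m, barred), u : 'I_N stands for
   absolute value u+1, m : 'I_l the colour, barred flag. *)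
Definition Letter (l N : nat) := ('I_N * 'I_l * bool)%type.

Section Ornaments.
Variables (l N : nat).
Local Notation L := (Letter l N).

Definition labs (x : L) : 'I_N := x.1.1.
Definition lcol (x : L) : nat := x.1.2.
Definition lbar (x : L) : bool := x.2.

Definition valid_letter (x : L) : bool := lbar x ==> (lcol x == 0%N).

Definition primitive (w : seq L) : bool :=
  ~~ [exists d : 'I_(size w).+1,
        [&& (1 < d)%N, (d %| size w)%N &
            w == flatten (nseq d (take (size w %/ d) w))]].

Definition succ_ok (x y : L) : bool :=
  (lbar x ==> (labs y <= labs x)%N) &&
  ((~~ lbar x && (lcol x == 0%N)) ==> (labs x <= labs y)%N).

Definition necklace_word (p : nat) (w : p.-tuple L) : bool :=
  [&& (0 < p)%N, all valid_letter w, primitive w,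
      [forall i : 'I_p, succ_ok (tnth w i) (tnth w (ordS i))] &
      (p != 1%N) || [forall i : 'I_p, ~~ lbar (tnth w i)]].

(* the set of rotations of a word = the circular word *)
Definition rotset (p : nat) (w : p.-tuple L) : {set p.-tuple L} :=
  [set [tuple of rot i w] | i : 'I_p].

Definition is_necklace (p : nat) (S : {set p.-tuple L}) : bool :=
  [exists w : p.-tuple L, necklace_word w && (S == rotset w)].

(* weight and colour statistic of a necklace (computed on a representative;
   both are rotation invariant) *)
Definition neck_wt (p : nat) (S : {set p.-tuple L}) : {mpoly int[N]} :=
  if [pick w in S] is Some w then \prod_(i < p) 'X_(labs (tnth w i)) else 1.

Definition neck_stat (p : nat) (S : {set p.-tuple L}) : nat :=
  if [pick w in S] is Some w then
    (\sum_(i < p) (l * lbar (tnth w i) + lcol (tnth w i)))%N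
  else 0%N.

(* An ornament with n letters in total = a multiset of necklaces, given as
   a multiplicity function on necklaces of length p <= n. *)
Definition Key (n : nat) := {p : 'I_n.+1 & {set p.-tuple L}}.

Definition orn_valid (n : nat) (f : {ffun Key n -> 'I_n.+1}) : bool :=
  [forall kk : Key n, (f kk != 0%N :> nat) ==> is_necklace (tagged kk)] &&
  ((\sum_(kk : Key n) tag kk * f kk)%N == n).

Definition orn_wt (n : nat) (f : {ffun Key n -> 'I_n.+1}) : {mpoly int[N]} :=
  \prod_(kk : Key n) neck_wt (tagged kk) ^+ f kk.

Definition orn_stat (n : nat) (f : {ffun Key n -> 'I_n.+1}) : nat :=
  (\sum_(kk : Key n) neck_stat (tagged kk) * f kk)%N.

Definition orn_j (n : nat) (f : {ffun Key n -> 'I_n.+1}) : nat :=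
  (\sum_(kk : Key n | (tag kk == 1%N :> nat) &&
       [exists w : (tag kk).-tuple L, (w \in tagged kk) &&
          [forall i, ~~ lbar (tnth w i) && (lcol (tnth w i) == 0%N)]]) f kk)%N.

Definition Qnkj (n k j : nat) : {mpoly int[N]} :=
  \sum_(f : {ffun Key n -> 'I_n.+1} |
          [&& orn_valid f, orn_stat f == k & orn_j f == j]) orn_wt f.

(* Q_{n,k} = sum_{j >= 0} Q_{n,k,j}; Q_{n,k,j} = 0 for j > n *)
Definition Qnk (n k : nat) : {mpoly int[N]} := \sum_(j < n.+1) Qnkj n k j.

End Ornaments.

(* Main.v *)
(** Give a letter [y] the weight [x_|y| t^c s^(l - c)], where [c] is its contribution to
    the colour statistic, and put [p = s^l], [q = t^l], [E_c(z) = prod_u (1 - c x_u z)],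
    [H_c = 1 / E_c].  The generating function of ornaments is
    [Q = 1 / prod_w (1 - wt(w) z^|w|)] over necklaces [w].  Since every cyclic word is a
    power of a unique primitive one, the logarithmic derivative of [Q / E_q] (the factor
    [1 / E_q] restores the one-letter barred necklaces) is the series of traces of the
    powers of the transfer matrix of letters, which reduces to a matrix [K] indexed by
    absolute values.  Solving [(1 - z K) v = D e_u] explicitly identifies that series
    with [- z D' / D] for [D = s E_p - t E_q], whence [Q D = (s - t) E_q].
    Then [G(s,t) = H_p (Q - 1) = s (E_q - E_p) / (E_p D)], and as the exchange of [s] and
    [t] negates [D], [s^2 G(t,s) - t^2 G(s,t) = s t (H_p - H_q)].  The theorem is the
    coefficient of [t^(a+1) z^n] at [s = 1], to which the right-hand side does not
    contribute because [1 < a + 1 < l n + 1]. *)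

Require Import Defs.
From HB Require Import structures.
From mathcomp Require Import all_boot all_order all_algebra ring zify.
From mathcomp Require Import finmap mpoly.
Set Implicit Arguments. Unset Strict Implicit. Unset Printing Implicit Defensive.
Import GRing.Theory.
Local Open Scope ring_scope.

(** * Power series as polynomials modulo ['X^M] *)

Section TruncatedSeries.
Variable R : comNzRingType.
Implicit Types (p q D S : {poly R}) (M : nat).

Definition vanish M p : Prop := forall i, (i < M)%N -> p`_i = 0.

Lemma vanish0 M : vanish M 0.
Proof. by move=> i _; rewrite coef0. Qed.

Lemma vanishD M p q : vanish M p -> vanish M q -> vanish M (p + q).
Proof. by move=> Hp Hq i Hi; rewrite coefD Hp // Hq // addr0. Qed.

Lemma vanishMl M q p : vanish M p -> vanish M (q * p).
Proof.
move=> Hp i Hi; rewrite coefM big1 // => j _.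
by rewrite Hp ?mulr0 // (leq_ltn_trans (leq_subr _ _)).
Qed.

Lemma vanishN M p : vanish M p -> vanish M (- p).
Proof. by move=> Hp i Hi; rewrite coefN Hp ?oppr0. Qed.

Lemma vanish_sum M (I : Type) (r : seq I) (P : pred I) (F : I -> {poly R}) :
  (forall i, P i -> vanish M (F i)) -> vanish M (\sum_(i <- r | P i) F i).
Proof. by move=> H; apply: big_ind => //; [apply: vanish0 | apply: vanishD]. Qed.

Lemma vanishW M M' p : (M <= M')%N -> vanish M' p -> vanish M p.
Proof. by move=> le Hp i Hi; apply/Hp/(leq_trans Hi). Qed.

Lemma vanish_mulXn M n p : (M <= n)%N -> vanish M (p * 'X^n).
Proof. by move=> le i Hi; rewrite coefMXn (leq_trans Hi). Qed.

Lemma vanish_prod1 M (I : Type) (r : seq I) (P : pred I) (F : I -> {poly R}) :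
  (forall i, P i -> vanish M (F i - 1)) -> vanish M (\prod_(i <- r | P i) F i - 1).
Proof.
move=> H; apply: (big_ind (fun p => vanish M (p - 1))) => //.
  by rewrite subrr; apply: vanish0.
move=> p q Hp Hq; have -> : p * q - 1 = q * (p - 1) + (q - 1) by ring.
by apply: vanishD => //; apply: vanishMl.
Qed.

Definition geom M (a : R) (k : nat) : {poly R} := \sum_(i < M) (a *: 'X^k) ^+ i.

(* [- X D' / D] for [D = 1 - a X^k], modulo ['X^M]. *)
Definition logder M (a : R) (k : nat) : {poly R} :=
  (a *: 'X^k *+ k) * geom M a k.

Lemma geomE M a k : geom M a k * (1 - a *: 'X^k) = 1 - a ^+ M *: 'X^(k * M).
Proof.
rewrite mulrC -{1}(expr1n _ M) /geom; set y := a *: _.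
have <- : y ^+ M = a ^+ M *: 'X^(k * M) by rewrite /y exprZn -exprM.
rewrite -[in RHS](expr1n _ M) subrXX expr1n; congr (_ * _).
by apply: eq_bigr => i _; rewrite expr1n mul1r.
Qed.

Lemma vanish_geom M a k : (0 < k)%N -> vanish M (geom M a k * (1 - a *: 'X^k) - 1).
Proof.
move=> k0; rewrite geomE addrAC subrr add0r; apply: vanishN.
by rewrite -mul_polyC; apply: vanish_mulXn; rewrite leq_pmull.
Qed.

Lemma vanish_logder1 M a k : (0 < k)%N ->
  vanish M ('X * (1 - a *: 'X^k)^`() + (1 - a *: 'X^k) * logder M a k).
Proof.
move=> k0; rewrite /logder.
have -> : 'X * (1 - a *: 'X^k)^`() = - (a *: 'X^k *+ k).
  rewrite derivB derivC derivZ derivXn sub0r mulrN -scalerAr mulrnAr.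
  by rewrite -exprS prednK // scalerMnr.
set u := _ *+ k; have -> : - u + (1 - a *: 'X^k) * (u * geom M a k) =
  u * (geom M a k * (1 - a *: 'X^k) - 1) by ring.
by apply: vanishMl; apply: vanish_geom.
Qed.

(** Logarithmic derivatives add over products; the form [X D' + D S = 0] avoids dividing by [D]. *)
Lemma vanish_logder M (I : Type) (r : seq I) (P : pred I) (a : I -> R) (k : I -> nat) :
  (forall i, P i -> (0 < k i)%N) ->
  vanish M ('X * (\prod_(i <- r | P i) (1 - a i *: 'X^(k i)))^`()
    + \prod_(i <- r | P i) (1 - a i *: 'X^(k i))
      * \sum_(i <- r | P i) logder M (a i) (k i)).
Proof.
move=> k0; apply: (big_rec2 (fun D S => vanish M ('X * D^`() + D * S))).
  by rewrite derivC !mulr0 addr0; apply: vanish0.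
move=> i D S /k0 ki H; rewrite derivM; set f := 1 - _.
have -> : 'X * (f^`() * D + f * D^`()) + f * D * (logder M (a i) (k i) + S) =
  D * ('X * f^`() + f * logder M (a i) (k i)) + f * ('X * D^`() + D * S) by ring.
by apply: vanishD; apply: vanishMl => //; apply: vanish_logder1.
Qed.

Lemma coef_logder M a k d : (0 < k)%N -> (d < M)%N ->
  (logder M a k)`_d = if (0 < d)%N && (k %| d)%N then a ^+ (d %/ k) *+ k else 0.
Proof.
move=> k0 dM; rewrite /logder /geom mulrnAl coefMn mulr_sumr coef_sum.
(* The factor in front of the geometric sum shifts the index, so only [i = d / k - 1] can
   contribute. For [d < k] the truncated subtraction points at [i = 0], where the inner test returns
   0. *)
have E (i : 'I_M) : (a *: 'X^k * (a *: 'X^k) ^+ i)`_d =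
    if (i == d %/ k - 1 :> nat)%N then
      if (0 < d)%N && (k %| d)%N then a ^+ (d %/ k) else 0 else 0.
  rewrite -exprS exprZn -exprM coefZ coefXn.
  case: eqP => [->|ne]; last first.
    rewrite mulr0; case: eqP => // ei; case: ifP => // /andP [d0 kd].
    case: ne; rewrite ei -{1}(divnK kd) mulnC subn1 prednK //.
    by rewrite divn_gt0 // dvdn_leq.
  rewrite mulr1 mulKn // subn1 eqxx dvdn_mulr // andbT.
  by rewrite muln_gt0 k0.
rewrite (eq_bigr _ (fun i _ => E i)) -big_mkcond /=.
have Hd : (d %/ k - 1 < M)%N.
  by rewrite (leq_ltn_trans _ dM) // (leq_trans (leq_subr _ _)) // leq_div.
rewrite (big_pred1 (Ordinal Hd)) => [|i] //.
by case: ifP => _; rewrite ?mul0rn.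
Qed.

(** The exponent chosen in each geometric factor acts as a multiplicity, so the coefficient
    enumerates multisets of total size [n] in the encoding used for ornaments. *)
Lemma coef_prod_geom (C : finType) (P : pred C) (k : C -> nat) (a : C -> R) (n : nat) :
  (\prod_(c | P c) geom n.+1 (a c) (k c))`_n =
  \sum_(f : {ffun C -> 'I_n.+1} | [forall c, (f c != 0%N :> nat) ==> P c]
      && (\sum_c k c * f c == n)%N) \prod_c a c ^+ f c.
Proof.
(* Extends the product to all [c], with only the exponent 0 outside [P], so that distributivity
   yields functions on all of [C]. *)
pose F c (i : 'I_n.+1) : {poly R} :=
  if (i != 0%N :> nat) ==> P c then (a c *: 'X^(k c)) ^+ i else 0.
have -> : \prod_(c | P c) geom n.+1 (a c) (k c) = \prod_c \sum_i F c i.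
  rewrite big_mkcond; apply: eq_bigr => c _; rewrite /geom /F.
  case: (P c); first by apply: eq_bigr => i _; rewrite implybT.
  rewrite (bigD1 ord0) //= expr0 big1 ?addr0 // => i.
  by rewrite -val_eqE /= => /negbTE ->.
rewrite bigA_distr_bigA coef_sum [RHS]big_mkcond /=; apply: eq_bigr => f _.
case: (boolP [forall _, _]) => [/forallP Hf|]; last first.
  rewrite negb_forall => /existsP [c Hc].
  by rewrite (bigD1 c) //= /F (negbTE Hc) mul0r coef0.
rewrite (eq_bigr (fun c => a c ^+ f c *: 'X^(k c * f c))); last first.
  by move=> c _; rewrite /F Hf exprZn -exprM.
rewrite scaler_prod -(big_morph (fun m => 'X^m) (exprD _) (expr0 _)).
by rewrite coefZ coefXn eq_sym; case: eqP => _; rewrite ?mulr1 ?mulr0.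
Qed.

(* The diagonal coefficients of approximate inverses [F n] of [D] assemble into
   an inverse of [D]. *)
Lemma vanish_diag_inverse M (a : nat -> R) (F : nat -> {poly R}) D :
  (forall n, (n < M)%N -> vanish n.+1 (F n * D - 1)) ->
  (forall n, (n < M)%N -> a n = (F n)`_n) ->
  vanish M ((\poly_(n < M) a n) * D - 1).
Proof.
move=> HF Ha i iM; have /(_ i (ltnSn i)) := HF i iM.
rewrite !coefB => H; rewrite -[RHS]H; congr (_ - _); rewrite !coefM; apply: eq_bigr => -[j /= ji] _.
have jM : (j < M)%N by apply: leq_trans iM.
rewrite coef_poly jM Ha //; congr (_ * _); apply/eqP; rewrite -subr_eq0 -coefB; apply/eqP.
(* Two approximate inverses of [D] agree up to the lower of their precisions. *)
have -> : F j - F i = F i * (F j * D - 1) - F j * (F i * D - 1) by ring.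
have V : vanish j.+1 (F i * (F j * D - 1) - F j * (F i * D - 1)).
  apply: vanishD; first by apply/vanishMl/HF.
  by apply/vanishN/vanishMl/(vanishW ji)/HF.
exact: V.
Qed.

(** In degree [i + 1] the derivative contributes [i + 1] times the coefficient of [Y], while
    [T_0 = 0] and the induction hypothesis kill [Y T]; torsion-freeness concludes. *)
Lemma vanish_ode M (T Y : {poly R}) :
  (forall n (x : R), (0 < n)%N -> x *+ n = 0 -> x = 0) ->
  T`_0 = 0 -> Y`_0 = 0 -> vanish M ('X * Y^`() + Y * T) -> vanish M Y.
Proof.
move=> tf T0 Y0 H i; elim/ltn_ind: i => -[//|i] IH Hi.
have := H _ Hi; rewrite coefD coefXM /= coef_deriv coefM big_ord_recr /=.
rewrite subnn T0 mulr0 addr0 big1 ?addr0 => [|j _]; last first.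
  by rewrite IH ?mul0r // (ltn_trans _ Hi).
exact: tf.
Qed.

End TruncatedSeries.

(** * Closed words as traces *)

Section Walks.
Variable R : comNzRingType.

(** The entry [(x, y)] of the [k]-th power of the matrix [g]. *)
Fixpoint walk (T : finType) (g : T -> T -> R) k (x y : T) : R :=
  if k is k'.+1 then \sum_z g x z * walk g k' z y else (x == y)%:R.

Lemma sum_eqr (T : finType) (F : T -> R) y : \sum_z F z * (z == y)%:R = F y.
Proof.
rewrite (bigD1 y) //= eqxx mulr1 big1 ?addr0 // => z /negbTE ->.
by rewrite mulr0.
Qed.

Lemma walkSr (T : finType) (g : T -> T -> R) k x y :
  walk g k.+1 x y = \sum_z walk g k x z * g z y.
Proof.
elim: k x => [|k IH] x.
  rewrite /= sum_eqr (bigD1 x) //= eqxx mul1r big1 ?addr0 // => z.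
  by rewrite eq_sym => /negbTE ->; rewrite mul0r.
rewrite [LHS]/= (eq_bigr (fun z => \sum_w g x z * (walk g k z w * g w y))).
  rewrite exchange_big /=; apply: eq_bigr => w _.
  by rewrite mulr_suml; apply: eq_bigr => z _; rewrite mulrA.
by move=> z _; rewrite -/(walk g k.+1 z y) IH mulr_sumr.
Qed.

Lemma sum_tuple_cons (T : finType) k (P : pred (k.+1.-tuple T)) F :
  \sum_(w | P w) F w =
  \sum_(x : T) \sum_(s : k.-tuple T | P [tuple of x :: s]) F [tuple of x :: s] :> R.
Proof.
rewrite pair_big_dep /= (reindex (fun p : T * k.-tuple T => [tuple of p.1 :: p.2])) //=.
apply: onW_bij; exists (fun w => (thead w, [tuple of behead w])).
  by case=> x s; congr pair; apply: val_inj.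
by move=> w; rewrite [RHS]tuple_eta.
Qed.

Section ClosedWords.
Variables (T : finType) (e : rel T) (f : T -> R).
(** A step carries the weight of the letter it leaves, so a closed walk weighs each letter of its
    word once. *)
Let g x y := if e x y then f x else 0.

Lemma sum_path k x y :
  \sum_(s : k.-tuple T | path e x (rcons s y)) f x * \prod_(z <- s) f z
  = walk g k.+1 x y.
Proof.
elim: k x => [|k IH] x.
  rewrite [RHS]/= sum_eqr big_mkcond (big_pred1 [tuple]) => [|s].
    by rewrite /= big_nil mulr1 andbT.
  by apply/esym/eqP; apply: tuple0.
rewrite [RHS]/= sum_tuple_cons; apply: eq_bigr => z _.
rewrite -/(walk g k.+1 z y) -IH mulr_sumr /g.
case: (boolP (e x z)) => exz; last first.
  by rewrite big_pred0 => [|s]; rewrite ?big1 // => *; rewrite ?mul0r //= (negbTE exz).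
apply: eq_big => s; first by rewrite /= exz.
by rewrite /= big_cons.
Qed.

Lemma sum_cycle k : (0 < k)%N ->
  \sum_(w : k.-tuple T | cycle e w) \prod_(z <- w) f z = \sum_x walk g k x x.
Proof.
case: k => // k _; rewrite sum_tuple_cons; apply: eq_bigr => x _.
by rewrite -sum_path; apply: eq_bigr => s _; rewrite big_cons.
Qed.
End ClosedWords.

(* tr (A B)^k = tr (B A)^k, where B is the incidence matrix of pi *)
Lemma walk_trace_proj (T I : finType) (pi : T -> I) (A : T -> I -> R) k :
  \sum_x walk (fun x y => A x (pi y)) k.+1 x x =
  \sum_u walk (fun u v => \sum_(x | pi x == u) A x v) k.+1 u u.
Proof.
pose g x y := A x (pi y); pose B u v := \sum_(x | pi x == u) A x v.
rewrite -/g -/B.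
(* Grouping the intermediate letters by their image under [pi] turns the walk after its first step
   into a walk of [B]. *)
have E j x y : walk g j.+1 x y = \sum_v A x v * walk B j v (pi y).
  elim: j x => [|j IH] x; first by rewrite /= !sum_eqr.
  rewrite [LHS]/= (partition_big pi predT) //=; apply: eq_bigr => u _.
  rewrite (eq_bigr (fun z => A x u * (\sum_v A z v * walk B j v (pi y)))).
    rewrite -mulr_sumr exchange_big /=; congr (_ * _); apply: eq_bigr => v _.
    by rewrite mulr_suml.
  by move=> z /eqP <-; rewrite -/(walk g j.+1 z y) IH.
rewrite (eq_bigr _ (fun x _ => E k x x)) (partition_big pi predT) //=.
apply: eq_bigr => u _; rewrite exchange_big /=.
rewrite (eq_bigr (fun v => (\sum_(x | pi x == u) A x v) * walk B k v u)) //.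
by move=> v _; rewrite mulr_suml; apply: eq_bigr => x /eqP <-.
Qed.

End Walks.

(** * The transfer matrix on absolute values *)

Section TransferMatrix.
Variables (R : comNzRingType) (N : nat) (x : 'I_N -> R) (s t p q L : R).
Hypothesis stL : (s - t) * L = p - q.
Variable M : nat.

Definition euler (c : R) : {poly R} := \prod_(w < N) (1 - (c * x w) *: 'X^1).

(** Total weight of the letters of absolute value [u] that may precede [v]: those of positive
    colour, plus the unbarred 0-coloured one if [u <= v], plus the barred one if [v <= u]. Here [L]
    stands for [(p - q) / (s - t)]. *)
Definition transfer (u v : 'I_N) : R :=
  x u * (if (u < v)%N then s * L else if (v < u)%N then t * L else s * L + q).

Definition Delta : {poly R} := s *: euler p - t *: euler q.

Local Notation P w := (1 - (p * x w) *: 'X^1).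
Local Notation Q w := (1 - (q * x w) *: 'X^1).

(* For fixed [u], [sig u r - sig u r.+1] is the [r]-th entry of the solution [v]
   of [(1 - X transfer) v = Delta e_u]: since [s sig_N = t sig_0], row [r] of this
   system reads [P_r sig_r - Q_r sig_{r+1} = Delta * (r == u)]. *)
Definition sig (u : 'I_N) (r : nat) : {poly R} :=
  (if (r <= u)%N then s else t) *:
  \prod_(w < N | w != u)
    (if (if (r <= u)%N then (w < r) || (u < w) else (u < w < r))%N then P w else Q w).

(** Away from [u], passing from [r] to [r + 1] only replaces the factor [Q r] by [P r]; the scalar
    changes from [s] to [t] just after [u]. *)
Lemma sig_step (u r : 'I_N) : r != u -> P r * sig u r = Q r * sig u r.+1.
Proof.
move=> ru; rewrite /sig !(bigD1 (P := fun w => w != u) r) //=.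
have E : (r < u)%N = (r <= u)%N by rewrite ltn_neqAle ru.
rewrite E ltnn leqnn /= andbT.
rewrite [(u < r)%N]ltnNge; case: (r <= u)%N => /=;
rewrite -!scalerAr; congr (_ *: _); rewrite mulrCA; congr (_ * (_ * _));
apply: eq_bigr => w /andP [_ /negbTE wr]; rewrite ltnS [(w <= r)%N]leq_eqVlt;
by rewrite -[_ == _ :> nat]/(w == r) wr.
Qed.

Lemma sig_at (u : 'I_N) :
  sig u u = s *: \prod_(w < N | w != u) P w /\
  sig u u.+1 = t *: \prod_(w < N | w != u) Q w.
Proof.
rewrite /sig leqnn ltnn; split; congr (_ *: _); apply: eq_bigr => w wu.
  by rewrite -neq_ltn wu.
by rewrite ltnS andbC leqNgt andNb.
Qed.

Lemma sig_wrap (u : 'I_N) : s *: sig u N = t *: sig u 0.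
Proof.
rewrite /sig leq0n leqNgt ltn_ord /= !scalerA [s * t]mulrC; congr (_ *: _).
by apply: eq_bigr => w _; rewrite ltn_ord andbT.
Qed.

Lemma sig_at_Delta (u : 'I_N) : P u * sig u u - Q u * sig u u.+1 = Delta.
Proof.
have [-> ->] := sig_at u.
by rewrite -!scalerAr /Delta /euler !(bigD1 (P := predT) u).
Qed.

Lemma sum_sig_lt (u r : 'I_N) :
  \sum_(w < N | (w < r)%N) (sig u w - sig u w.+1) = sig u 0 - sig u r.
Proof.
rewrite -(big_ord_widen _ (fun w => sig u w - sig u w.+1)) ?(ltnW (ltn_ord r)) //.
rewrite -(big_mkord predT (fun w => sig u w - sig u w.+1)).
rewrite (telescope_sumr_eq (fun w => - sig u w)) //; first by ring.
by move=> k _; ring.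
Qed.

Lemma sum_sig_gt (u r : 'I_N) :
  \sum_(w < N | (r < w)%N) (sig u w - sig u w.+1) = sig u r.+1 - sig u N.
Proof.
have tot : \sum_(w < N) (sig u w - sig u w.+1) = sig u 0 - sig u N.
  rewrite -(big_mkord predT (fun w => sig u w - sig u w.+1)).
  rewrite (telescope_sumr_eq (fun w => - sig u w)) //; first by ring.
  by move=> k _; ring.
move: tot; rewrite (bigID (fun w : 'I_N => (w < r)%N)) /= sum_sig_lt.
rewrite (bigD1 (P := fun w : 'I_N => ~~ (w < r)%N) r) ?ltnn //=.
rewrite (eq_bigl (fun w : 'I_N => (r < w)%N)) => [H|w].
  by apply: (addrI (sig u 0 - sig u r + (sig u r - sig u r.+1))); rewrite -addrA H; ring.
by rewrite -leqNgt ltn_neqAle andbC -val_eqE eq_sym.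
Qed.

(** The sums over [w > r] and [w < r] telescope. Their boundary terms at [N] and [0] cancel by
    [sig_wrap], and [(s - t) L = p - q] simplifies what remains at [r]. *)
Lemma transfer_sig (u r : 'I_N) :
  \sum_w transfer r w *: (sig u w - sig u w.+1) =
  x r *: (p *: sig u r - q *: sig u r.+1).
Proof.
rewrite (eq_bigr (fun w : 'I_N => x r *: ((if (r < w)%N then s * L
   else if (w < r)%N then t * L else s * L + q) *: (sig u w - sig u w.+1)))); last first.
  by move=> w _; rewrite scalerA.
rewrite -scaler_sumr; congr (_ *: _).
rewrite (bigID (fun w : 'I_N => (r < w)%N)) /=.
rewrite (eq_bigr (fun w : 'I_N => (s * L) *: (sig u w - sig u w.+1))); last by move=> w ->.
rewrite -scaler_sumr sum_sig_gt.
rewrite (bigID (fun w : 'I_N => (w < r)%N)) /=.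
rewrite (eq_bigl (fun w : 'I_N => (w < r)%N)); last first.
  by move=> w /=; case: ltngtP.
rewrite (eq_bigr (fun w : 'I_N => (t * L) *: (sig u w - sig u w.+1))); last first.
  by move=> w H; rewrite ltnNge (ltnW H) H.
rewrite -scaler_sumr sum_sig_lt (big_pred1 r) => [|w]; last first.
  by rewrite -!leqNgt -eqn_leq -[_ == _]/(w == r).
rewrite !ltnn -!mul_polyC; have := sig_wrap u; rewrite -!mul_polyC => W.
have E : (s%:P - t%:P) * L%:P = p%:P - q%:P by rewrite -!polyCB -polyCM stL.
rewrite polyCD !polyCM; move: W E; set S := sig u N.
move: (sig u 0) (sig u r) (sig u r.+1) => A B C W E.
have -> : p%:P = q%:P + (s%:P - t%:P) * L%:P by rewrite E; ring.
have -> : s%:P * L%:P * (C - S) = s%:P * L%:P * C - L%:P * (s%:P * S) by ring.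
by rewrite W; ring.
Qed.

(** The entry [(u, v)] of the inverse of [1 - X transfer], modulo [X^M]. *)
Definition wseries (u v : 'I_N) : {poly R} := \poly_(k < M) walk transfer k u v.

Lemma vanish_wseries (u w : 'I_N) :
  vanish M (wseries u w - 'X * (\sum_r wseries u r * (transfer r w)%:P) - (u == w)%:R).
Proof.
move=> i iM; rewrite !coefB coefXM coef_poly iM coef_sum.
have -> : ((u == w)%:R : {poly R}) = (u == w)%:R%:P by rewrite polyC_natr.
rewrite coefC; case: i iM => [|i] iM /=; first by rewrite subr0 subrr.
rewrite -/(walk transfer i.+1 u w) walkSr subr0; apply/eqP; rewrite subr_eq0; apply/eqP.
by apply: eq_bigr => r _; rewrite coefMC coef_poly (ltn_trans _ iM).
Qed.

(** Applying the left inverse [wseries] to [(1 - X transfer) v = Delta e_u] gives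
    [wseries u u * Delta = v u], and [sig_at] evaluates [v u]. *)
Lemma vanish_resolvent (u : 'I_N) :
  vanish M (wseries u u * Delta
    - (s *: \prod_(w < N | w != u) P w - t *: \prod_(w < N | w != u) Q w)).
Proof.
have [<- <-] := sig_at u; pose v (r : nat) := sig u r - sig u r.+1.
have row (r : 'I_N) : v r - 'X * (\sum_w transfer r w *: v w) = Delta *+ (r == u).
  rewrite transfer_sig /v; case: eqP => [->|/eqP ru].
    rewrite -(sig_at_Delta u) mulr1n expr1 -!scalerA -!mul_polyC.
    by ring.
  have := sig_step ru; rewrite expr1 mulr0n -!mul_polyC !polyCM => H.
  apply: (addIr ((1 - q%:P * (x r)%:P * 'X) * sig u r.+1)); rewrite add0r -{}[RHS]H.
  by ring.
have -> : wseries u u * Delta = \sum_r wseries u r * (v r - 'X * (\sum_w transfer r w *: v w)).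
  rewrite (bigD1 u) //= row eqxx mulr1n big1 ?addr0 // => r /negbTE ru.
  by rewrite row ru mulr0n mulr0.
suff -> : \sum_r wseries u r * (v r - 'X * (\sum_w transfer r w *: v w)) - v u =
    \sum_(w < N) v w * (wseries u w - 'X * (\sum_r wseries u r * (transfer r w)%:P)
                        - (u == w)%:R).
  by apply: vanish_sum => w _; apply: vanishMl; apply: vanish_wseries.
pose Y (r w : 'I_N) := wseries u r * (transfer r w *: v w).
rewrite (eq_bigr (fun r : 'I_N => v r * wseries u r - 'X * \sum_w Y r w)); last first.
  by move=> r _; rewrite -mulr_sumr; ring.
rewrite [RHS](eq_bigr (fun w : 'I_N =>
    v w * wseries u w - 'X * (\sum_r Y r w) - v w * (u == w)%:R)); last first.
  move=> w _; rewrite !mulrBr mulrCA; congr (_ - _ * _ - _).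
  by rewrite mulr_sumr; apply: eq_bigr => r _; rewrite /Y -mul_polyC; ring.
rewrite !sumrB -!mulr_sumr exchange_big /=; congr (_ - _).
rewrite (bigD1 u) //= eqxx mulr1 big1 ?addr0 // => w.
by rewrite eq_sym => /negbTE ->; rewrite mulr0.
Qed.

(** Since [X (1 - a X)' = (1 - a X) - 1], the Leibniz rule produces the products with one factor
    left out, which are those of [vanish_resolvent]. *)
Lemma vanish_deriv_euler (c : R) :
  vanish M ('X * (euler c)^`()
    - \sum_(u < N) (euler c - \prod_(w < N | w != u) (1 - (c * x w) *: 'X^1))).
Proof.
have H := @vanish_logder R M 'I_N (index_enum _) predT (fun w => c * x w) (fun=> 1%N)
  (fun _ _ => isT).
rewrite -/(euler c) in H.
set S := \sum_(u < N) _; set G := \sum_(i < N) _ in H.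
have -> : 'X * (euler c)^`() - S = 'X * (euler c)^`() + euler c * G - (S + euler c * G) by ring.
apply: vanishD => //; apply: vanishN; rewrite /S /G mulr_sumr -big_split /=.
apply: vanish_sum => u _; rewrite /euler (bigD1 u) //= /logder mulr1n.
set a := (c * x u) *: 'X^1; set e := \prod_(i < N | _) _; set g := geom _ _ _.
have -> : (1 - a) * e - e + (1 - a) * e * (a * g) = e * a * (g * (1 - a) - 1) by ring.
by apply: vanishMl; apply: vanish_geom.
Qed.

(** Summing the diagonal of the resolvent gives the equation that [det (1 - X transfer)] satisfies,
    without introducing a determinant. *)
Lemma vanish_deriv_Delta :
  vanish M ('X * Delta^`() + Delta * \sum_(u < N) (wseries u u - 1)).
Proof.
rewrite /Delta derivB !derivZ -/Delta.
have Hp := vanish_deriv_euler p; have Hq := vanish_deriv_euler q.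
set Sp := \sum_(u < N) _ in Hp; set Sq := \sum_(u < N) _ in Hq.
have HW := @vanish_sum R M 'I_N (index_enum _) predT _ (fun u _ => vanish_resolvent u).
set W := \sum_(u < N) _ in HW.
have -> : 'X * (s *: (euler p)^`() - t *: (euler q)^`()) + Delta * \sum_(u < N) (wseries u u - 1)
  = s%:P * ('X * (euler p)^`() - Sp) - t%:P * ('X * (euler q)^`() - Sq) + W.
  have -> : Delta * \sum_(u < N) (wseries u u - 1) = W - s *: Sp + t *: Sq.
    rewrite mulr_sumr /Sp /Sq !scaler_sumr /W -sumrN -!big_split /=.
    apply: eq_bigr => u _; rewrite /Delta -!mul_polyC; ring.
  by rewrite -!mul_polyC; ring.
by do ?apply: vanishD; rewrite // -?mulNr; apply: vanishMl.
Qed.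

End TransferMatrix.

(** * Primitive words and necklaces *)

(** Bezout: [km * p = kn * q + gcdn p q], so a shift by the gcd followed by [kn] shifts by [q]
    amounts to [km] shifts by [p]. *)
Lemma period_gcdn (T : Type) (f : nat -> T) p q : (0 < p)%N ->
  (forall i, f (i + p)%N = f i) -> (forall i, f (i + q)%N = f i) ->
  forall i, f (i + gcdn p q)%N = f i.
Proof.
have mult m : (forall i, f (i + m)%N = f i) -> forall k i, f (i + k * m)%N = f i.
  move=> H; elim=> [|k IH] i; first by rewrite addn0.
  by rewrite mulSn addnA IH H.
move=> p0 /mult Hp /mult Hq i; case: (egcdnP q p0) => km kn E _.
by rewrite -(Hq kn) -addnA [(gcdn _ _ + _)%N]addnC -E Hp.
Qed.

Lemma period_modn (T : Type) (f : nat -> T) p :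
  (forall i, f (i + p)%N = f i) -> forall i, f (i %% p)%N = f i.
Proof.
move=> H i; rewrite [in RHS](divn_eq i p); elim: (i %/ p)%N => [|k IH] //.
by rewrite mulSn -addnA addnC H.
Qed.

Section Words.
Variables (l N : nat).
Local Notation T := (Letter l N).
Implicit Types (s u v w : seq T).

Definition wpow d w := flatten (nseq d w).

Lemma size_wpow d w : size (wpow d w) = (d * size w)%N.
Proof. by elim: d => //= d IH; rewrite size_cat IH mulSn. Qed.

Lemma nth_wpow x0 d w i :
  (i < d * size w)%N -> nth x0 (wpow d w) i = nth x0 w (i %% size w).
Proof.
elim: d i => // d IH i; rewrite mulSn /wpow /= nth_cat => H.
case: ltnP => Hi; first by rewrite modn_small.
rewrite IH; last by rewrite ltn_subLR.
by rewrite -[in RHS](subnK Hi) modnDr.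
Qed.

Lemma take_wpow d w : (0 < d)%N -> take (size w) (wpow d w) = w.
Proof. by case: d => // d _; rewrite take_size_cat. Qed.

Lemma wpowM d d' w : wpow d (wpow d' w) = wpow (d * d') w.
Proof.
elim: d => // d IH; rewrite mulSn -[LHS]/(wpow d' w ++ wpow d (wpow d' w)) IH.
by rewrite /wpow nseqD flatten_cat.
Qed.

Lemma prod_wpow (R : comNzRingType) (f : T -> R) d w :
  \prod_(z <- wpow d w) f z = (\prod_(z <- w) f z) ^+ d.
Proof.
elim: d => [|d IH]; first by rewrite big_nil.
by rewrite -[wpow d.+1 w]/(w ++ wpow d w) big_cat /= IH exprS.
Qed.

(** Each junction between two copies of [w] is the pair of letters that already closes the cycle of
    [w]. *)
Lemma cycle_wpow (e : rel T) d w : (0 < d)%N -> cycle e (wpow d w) = cycle e w.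
Proof.
case: w => [|x s]; first by move=> _; elim: d.
case: d => // d _; change (path e x (rcons (s ++ wpow d (x :: s)) x) = path e x (rcons s x)).
elim: d => [|d IH]; first by rewrite cats0.
have -> : rcons (s ++ wpow d.+1 (x :: s)) x = rcons s x ++ rcons (s ++ wpow d (x :: s)) x.
  by rewrite -[wpow d.+1 _]/((x :: s) ++ wpow d (x :: s)) !rcons_cat cat_rcons.
by rewrite cat_path last_rcons IH andbb.
Qed.

Lemma primitivePn w : (0 < size w)%N -> ~~ primitive w ->
  exists d, [/\ (1 < d)%N, (d %| size w)%N & w = wpow d (take (size w %/ d) w)].
Proof.
by move=> _; rewrite negbK => /existsP [d /and3P [H1 H2 /eqP H3]]; exists d.
Qed.

Lemma primitiveP d w : primitive w -> (0 < size w)%N -> (d %| size w)%N ->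
  w = wpow d (take (size w %/ d) w) -> (d <= 1)%N.
Proof.
move=> pw w0 dw E; rewrite leqNgt; apply: contraL pw => d1; rewrite negbK.
have dn : (d < (size w).+1)%N by rewrite ltnS dvdn_leq.
by apply/existsP; exists (Ordinal dn); apply/and3P; split=> //; apply/eqP.
Qed.

(** The word read cyclically: rotations and powers become statements about a periodic function on
    [nat]. *)
Definition letter_at x0 w i := nth x0 w (i %% size w).

Lemma letter_at_wpow x0 d w i : (0 < d)%N ->
  letter_at x0 (wpow d w) i = letter_at x0 w i.
Proof.
move=> d0; rewrite /letter_at size_wpow.
case: (posnP (size w)) => [/size0nil ->|w0].
  by rewrite !nth_default // size_wpow muln0.
by rewrite nth_wpow ?ltn_pmod ?muln_gt0 ?d0 // modn_dvdm // dvdn_mull.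
Qed.

Lemma letter_at_size x0 w i : letter_at x0 w (i + size w) = letter_at x0 w i.
Proof. by rewrite /letter_at modnDr. Qed.

Lemma eq_letter_at x0 u w : size u = size w -> letter_at x0 u =1 letter_at x0 w -> u = w.
Proof.
move=> suw H; apply: (@eq_from_nth _ x0) => // i Hi.
by have := H i; rewrite /letter_at -suw !modn_small.
Qed.

Lemma wpow_period x0 w g : (0 < size w)%N -> (g %| size w)%N ->
  (forall i, letter_at x0 w (i + g) = letter_at x0 w i) ->
  w = wpow (size w %/ g) (take g w).
Proof.
move=> w0 gw H; have g0 := dvdn_gt0 w0 gw.
have tg : size (take g w) = g by rewrite size_takel // dvdn_leq.
have sz : size (wpow (size w %/ g) (take g w)) = size w by rewrite size_wpow tg divnK.
apply: (@eq_letter_at x0) => // i; rewrite letter_at_wpow ?divn_gt0 ?(dvdn_leq w0) //.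
rewrite [RHS]/letter_at tg nth_take ?ltn_pmod // -(period_modn H).
by rewrite /letter_at modn_small // (leq_trans (ltn_pmod _ g0)) // dvdn_leq.
Qed.

(** The gcd [g] of [m] and the length is again a period, so [w] is a power with exponent
    [size w / g], which primitivity forces to be 1. *)
Lemma primitive_period x0 w m : (0 < size w)%N -> primitive w ->
  (forall i, letter_at x0 w (i + m) = letter_at x0 w i) -> (size w %| m)%N.
Proof.
move=> w0 pw H; set g := gcdn (size w) m.
have gw : (g %| size w)%N := dvdn_gcdl _ _.
have E := wpow_period w0 gw (period_gcdn w0 (letter_at_size x0 w) H).
have := primitiveP pw w0 (dvdn_div gw); rewrite divnA // mulKn // => /(_ E).
rewrite leq_eqVlt ltnS leqn0 => /orP [/eqP E1|/eqP E0].
  by rewrite -(divnK gw) E1 mul1n dvdn_gcdr.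
by move: w0; rewrite -(divnK gw) E0.
Qed.

Lemma not_primitive_period x0 w : (0 < size w)%N -> ~~ primitive w ->
  exists2 g, (0 < g < size w)%N & forall i, letter_at x0 w (i + g) = letter_at x0 w i.
Proof.
move=> w0 /(primitivePn w0) [d [d1 dw E]]; exists (size w %/ d)%N.
  by rewrite divn_gt0 ?(ltnW d1) // (dvdn_leq w0 dw) ltn_Pdiv.
have sz : size (take (size w %/ d) w) = (size w %/ d)%N by rewrite size_takel ?leq_div.
move: (size w %/ d)%N E sz => g E sz i.
by rewrite E !letter_at_wpow ?(ltnW d1) // /letter_at sz modnDr.
Qed.

Lemma primitive_root w : (0 < size w)%N ->
  exists2 v, primitive v & exists2 d, (0 < d)%N & w = wpow d v.
Proof.
have [n] := ubnP (size w); elim: n w => // n IH w wn w0.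
case: (boolP (primitive w)) => [pw|/(primitivePn w0) [d [d1 dw E]]].
  by exists w => //; exists 1%N => //; rewrite /wpow /= cats0.
have sz : size (take (size w %/ d) w) = (size w %/ d)%N by rewrite size_takel ?leq_div.
have [||v pv [e e0 Ev]] := IH (take (size w %/ d) w).
- by rewrite sz (leq_trans (ltn_Pdiv d1 w0)).
- by rewrite sz divn_gt0 ?(ltnW d1) // (dvdn_leq w0 dw).
by exists v => //; exists (d * e)%N; rewrite ?muln_gt0 ?e0 ?(ltnW d1) // -wpowM -Ev.
Qed.

(** Both words have the same periodic extension, so the length of each is a period of the other. *)
Lemma primitive_root_size u v d e : (0 < size u)%N -> (0 < size v)%N ->
  primitive u -> primitive v -> (0 < d)%N -> (0 < e)%N ->
  wpow d u = wpow e v -> size u = size v.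
Proof.
case: u => // x0 u' u0 v0; set u := x0 :: u'; move=> pu pv d0 e0 E.
have H i : letter_at x0 u i = letter_at x0 v i.
  by rewrite -(letter_at_wpow x0 u i d0) E letter_at_wpow.
apply/eqP; rewrite eqn_dvd; apply/andP; split.
  by apply: (@primitive_period x0) => // i; rewrite !H letter_at_size.
by apply: (@primitive_period x0) => // i; rewrite -!H letter_at_size.
Qed.

(** Plain sequences, so that a word and its root, of different lengths, share one type. *)
Definition words k := [seq val t | t <- enum {: k.-tuple T}].

Lemma mem_words k w : (w \in words k) = (size w == k).
Proof.
apply/mapP/eqP => [[t _ ->]|/eqP wk]; first exact: size_tuple.
by exists (Tuple wk); rewrite ?mem_enum.
Qed.

Lemma uniq_words k : uniq (words k).
Proof. by rewrite map_inj_uniq ?enum_uniq //; apply: val_inj. Qed.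

Lemma sum_words (R : comNzRingType) k (P : pred (seq T)) (F : seq T -> R) :
  \sum_(t : k.-tuple T | P t) F t = \sum_(w <- words k | P w) F w.
Proof. by rewrite big_map big_enum_cond. Qed.

(** For [w] of length [k]: the primitive root of [w] has length [p]. *)
Definition is_root k p w :=
  [&& (p %| k)%N, primitive (take p w) & w == wpow (k %/ p) (take p w)].

Lemma is_root_unique k w : (0 < k)%N -> size w = k ->
  exists p0 : 'I_k.+1, forall p : 'I_k.+1, is_root k p w = (p == p0).
Proof.
move=> k0 wk; have w0 : (0 < size w)%N by rewrite wk.
have [v pv [d d0 E]] := primitive_root w0.
have dv : (d * size v)%N = k by rewrite -wk E size_wpow.
have v0 : (0 < size v)%N by move: k0; rewrite -dv muln_gt0 => /andP [].
have kv : (k %/ size v)%N = d by rewrite -dv mulnK.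
have vk : (size v < k.+1)%N by rewrite ltnS -dv leq_pmull.
exists (Ordinal vk) => p; apply/idP/eqP => [/and3P [pk pp /eqP Ep]|->].
  have p0 := dvdn_gt0 k0 pk.
  have sp : size (take p w) = p by rewrite size_takel // wk dvdn_leq.
  apply: val_inj; rewrite /= -[LHS]sp.
  apply: (@primitive_root_size _ _ (k %/ p) d) => //; rewrite ?sp //.
    by rewrite divn_gt0 // dvdn_leq.
  by rewrite -Ep.
by rewrite /is_root /= kv E take_wpow // pv eqxx -dv dvdn_mull.
Qed.

(** Words are sorted by the length [p] of their root; [v |-> v^(k/p)] is a bijection from primitive
    words of length [p] that preserves cyclic admissibility and raises the weight to the power
    [k/p]. *)
Lemma sum_primitive_roots (R : comNzRingType) (e : rel T) (f : T -> R) k :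
  (0 < k)%N ->
  \sum_(w : k.-tuple T | cycle e w) \prod_(z <- w) f z =
  \sum_(p < k.+1 | (p %| k)%N)
    \sum_(v : p.-tuple T | primitive v && cycle e v) (\prod_(z <- v) f z) ^+ (k %/ p).
Proof.
move=> k0; rewrite (sum_words k (cycle e) (fun w => \prod_(z <- w) f z)) big_seq_cond.
rewrite (eq_bigr (fun w => \sum_(p < k.+1 | is_root k p w) \prod_(z <- w) f z)); last first.
  move=> w /andP [/[!mem_words] /eqP wk _].
  by have [p0 H] := is_root_unique k0 wk; rewrite (big_pred1 p0).
rewrite -big_seq_cond (exchange_big_dep (fun p : 'I_k.+1 => (p %| k)%N)) /=; last first.
  by move=> w p _ /and3P [].
apply: eq_bigr => p pk.
rewrite (sum_words p (fun v => primitive v && cycle e v)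
          (fun v => (\prod_(z <- v) f z) ^+ (k %/ p))).
rewrite -big_filter -[RHS]big_filter.
have p0 := dvdn_gt0 k0 pk; have d0 : (0 < k %/ p)%N by rewrite divn_gt0 // dvdn_leq.
rewrite [RHS](eq_bigr (fun v => \prod_(z <- wpow (k %/ p) v) f z)); last first.
  by move=> v _; rewrite prod_wpow.
rewrite -(big_map (wpow (k %/ p)) predT (fun w => \prod_(z <- w) f z)).
apply: perm_big; apply: uniq_perm; first by rewrite filter_uniq ?uniq_words.
  rewrite map_inj_in_uniq ?filter_uniq ?uniq_words // => u v.
  rewrite !mem_filter !mem_words => /andP [_ /eqP su] /andP [_ /eqP sv] E.
  by rewrite -(take_wpow u d0) -(take_wpow v d0) su sv E.
move=> w; rewrite mem_filter mem_words; apply/idP/mapP.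
  case/andP => /andP [cw /and3P [_ pp /eqP Ep]] /eqP wk; exists (take p w) => //.
  have sz : size (take p w) = p by rewrite size_takel // wk dvdn_leq.
  rewrite mem_filter mem_words sz eqxx andbT pp /=.
  by move: cw; rewrite {1}Ep cycle_wpow.
case=> v; rewrite mem_filter mem_words => /andP [/andP [pv cv] /eqP sv] ->.
rewrite cycle_wpow // cv size_wpow sv divnK // eqxx andbT.
by have := take_wpow v d0; rewrite /is_root pk sv => ->; rewrite pv eqxx.
Qed.

End Words.

(** * Rotation classes of primitive words *)

Section Rotations.
Variables (l N : nat).
Local Notation T := (Letter l N).

Lemma letter_at_rot (x0 : T) (w : seq T) i j : (i <= size w)%N ->
  letter_at x0 (rot i w) j = letter_at x0 w (j + i).
Proof.
move=> iw; case: (posnP (size w)) => [/size0nil ->|w0].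
  by rewrite /letter_at !nth_default.
rewrite /letter_at size_rot -modnDml; have := ltn_pmod j w0.
move: (j %% size w)%N => b bw; rewrite /rot nth_cat size_drop.
case: ltnP => H; first by rewrite nth_drop modn_small; [rewrite addnC | lia].
rewrite nth_take; last by lia.
have -> : (b + i = (b - (size w - i)) + size w)%N by lia.
by rewrite modnDr modn_small //; lia.
Qed.

Lemma rot_period (x0 : T) (w : seq T) i j g : (0 < size w)%N -> (i <= size w)%N ->
  (j <= size w)%N ->
  (forall k, letter_at x0 (rot i w) (k + g) = letter_at x0 (rot j w) k) ->
  forall k, letter_at x0 w (k + (g + i)) = letter_at x0 w (k + j).
Proof.
move=> w0 iw jw H k.
by have := H k; rewrite !letter_at_rot // addnA.
Qed.

Lemma letter_at_shift (x0 : T) (w : seq T) i m : (0 < size w)%N ->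
  (forall k, letter_at x0 w (k + (m + i)) = letter_at x0 w (k + i)) ->
  forall k, letter_at x0 w (k + m) = letter_at x0 w k.
Proof.
(* A shift by [i] is undone by [i * (size w - 1)] more, since the total is a multiple of the
   length. *)
move=> w0 H k; have E j : letter_at x0 w (j + i * (size w).-1 + i) = letter_at x0 w j.
  rewrite /letter_at; congr nth.
  rewrite -addnA -{2}[i]muln1 -mulnDr addn1 prednK //.
  by rewrite addnC modnMDl.
by rewrite -(E (k + m)%N) -[RHS]E -[RHS]H; congr letter_at; lia.
Qed.

Lemma primitive_rot (w : seq T) i : (0 < size w)%N -> (i <= size w)%N ->
  primitive w -> primitive (rot i w).
Proof.
move=> w0 iw pw; case: (boolP (primitive (rot i w))) => // npw.
have [x0 _] : exists x0 : T, True by case: w w0 {iw pw npw} => // x0; exists x0.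
have [|g /andP [g0 gw] H] := not_primitive_period x0 _ npw; first by rewrite size_rot.
rewrite size_rot in gw.
have := primitive_period w0 pw (letter_at_shift w0 (rot_period w0 iw iw H)).
by move=> /(dvdn_leq g0); rewrite leqNgt gw.
Qed.

(** Equal rotations would give the period [j - i], smaller than the length. *)
Lemma primitive_rot_inj (w : seq T) i j : primitive w -> (i < j < size w)%N ->
  rot i w <> rot j w.
Proof.
move=> pw /andP [ij jw] E; have w0 : (0 < size w)%N by apply: leq_trans jw.
have [x0 _] : exists x0 : T, True by case: w w0 {ij jw E pw} => // x0; exists x0.
have H k : letter_at x0 w (k + ((j - i) + i)) = letter_at x0 w (k + i).
  rewrite subnK ?(ltnW ij) // -!letter_at_rot ?E //; lia.
have := primitive_period w0 pw (letter_at_shift w0 H).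
by move/dvdn_leq; lia.
Qed.

Lemma cycle_tupleE p (e : rel T) (w : p.-tuple T) :
  [forall i : 'I_p, e (tnth w i) (tnth w (ordS i))] = cycle e w.
Proof.
case: p w => [w|p w]; first by rewrite [w]tuple0 /=; apply/forallP => -[].
case/tupleP: w => x s /=.
have nthS i : (i < p.+1)%N ->
    nth x (rcons s x) i = nth x (x :: s) (i.+1 %% p.+1).
  rewrite ltnS leq_eqVlt => /orP [/eqP ->|ip].
    by rewrite modnn /= -{2}(size_tuple s) nth_rcons ltnn eqxx.
  by rewrite modn_small // nth_rcons size_tuple ip.
apply/forallP/(pathP x) => [H i|H i].
  rewrite size_rcons size_tuple => Hi; have := H (Ordinal Hi).
  rewrite !(tnth_nth x) /= nthS //; congr e.
  by case: i Hi => //= i; rewrite ltnS => Hi; rewrite nth_rcons size_tuple Hi.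
have sz : size (rcons s x) = p.+1 by rewrite size_rcons size_tuple.
have := H i; rewrite sz => /(_ (ltn_ord i)); rewrite nthS // !(tnth_nth x) /=.
by case: i => -[|i] //= Hi; rewrite nth_rcons size_tuple -ltnS Hi.
Qed.

Lemma necklace_wordE p (w : p.-tuple T) :
  necklace_word w = [&& (0 < p)%N, all (@valid_letter l N) w, primitive w,
    cycle (@succ_ok l N) w & (p != 1%N) || all (fun z => ~~ lbar z) w].
Proof.
rewrite /necklace_word cycle_tupleE; do 4!congr (_ && _); congr (_ || _).
by apply/forallP/all_tnthP.
Qed.

Lemma necklace_word_rot p (w : p.-tuple T) i : (i <= p)%N ->
  necklace_word w -> necklace_word [tuple of rot i w].
Proof.
rewrite !necklace_wordE => ip /and5P [p0 vw pw cw nw] /=; rewrite p0.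
have perm : perm_eq (rot i w) w by rewrite perm_rot.
rewrite !(perm_all _ perm) vw rot_cycle cw nw !andbT.
by rewrite primitive_rot ?size_tuple.
Qed.

Lemma card_rotset p (w : p.-tuple T) : primitive w -> #|rotset w| = p.
Proof.
move=> pw; rewrite card_in_imset ?card_ord // => i j _ _ /(congr1 val) /= E.
apply: val_inj => /=; case: (ltngtP i j) => // ij.
  by case: (@primitive_rot_inj w i j) => //; rewrite ij size_tuple ltn_ord.
by case: (@primitive_rot_inj w j i) => //; rewrite ij size_tuple ltn_ord.
Qed.

Lemma mem_rotset p (w : p.-tuple T) : (0 < p)%N -> w \in rotset w.
Proof.
move=> p0; apply/imsetP; exists (Ordinal p0) => //.
by apply: val_inj; rewrite /= rot0.
Qed.

(** One inclusion suffices, because primitivity gives both sets cardinality [p]. *)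
Lemma rotset_rot p (w : p.-tuple T) i : (i < p)%N -> necklace_word w ->
  rotset [tuple of rot i w] = rotset w.
Proof.
move=> ip nw; have p0 : (0 < p)%N by apply: leq_trans ip.
have prim v : necklace_word v -> primitive (v : p.-tuple T).
  by rewrite necklace_wordE => /and5P [].
apply/eqP; rewrite eqEcard !card_rotset ?leqnn ?prim ?necklace_word_rot ?(ltnW ip) // andbT.
apply/subsetP => v /imsetP [j _ ->].
have H k : (k <= p)%N -> [tuple of rot k w] \in rotset w.
  rewrite leq_eqVlt => /orP [/eqP E|kp]; last by apply/imsetP; exists (Ordinal kp).
  rewrite (_ : [tuple of _] = w) ?mem_rotset //.
  by apply: val_inj => /=; apply: rot_oversize; rewrite size_tuple E.
pose k := if (j + i <= p)%N then (j + i)%N else (j + i - p)%N.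
rewrite (_ : [tuple of _] = [tuple of rot k w]).
  by apply: H; rewrite /k; case: (leqP (j + i) p) => // _;
    rewrite leq_subLR leq_add // ltnW.
by apply: val_inj; rewrite /= rot_add_mod size_tuple // ltnW.
Qed.

Lemma rotset_class p (v w : p.-tuple T) : necklace_word w ->
  (v \in rotset w) = necklace_word v && (rotset v == rotset w).
Proof.
move=> nw; have p0 : (0 < p)%N by case/andP: nw.
apply/idP/idP => [/imsetP [i _ ->]|/andP [_ /eqP <-]]; last exact: mem_rotset.
by rewrite necklace_word_rot ?(ltnW (ltn_ord i)) // rotset_rot // eqxx.
Qed.

(** A necklace consists of exactly [p] words; this accounts for the factor [k] in the coefficients
    of [logder]. *)
Lemma sum_necklaces (R : nmodType) p (F : {set p.-tuple T} -> R) :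
  \sum_(S | is_necklace S) F S *+ p = \sum_(w : p.-tuple T | necklace_word w) F (rotset w).
Proof.
rewrite (partition_big (@rotset l N p) (@is_necklace l N p)) /=; last first.
  by move=> w nw; apply/existsP; exists w; rewrite nw eqxx.
apply: eq_bigr => S /existsP [w /andP [nw /eqP ->]].
rewrite (eq_bigr (fun _ => F (rotset w))); last by move=> v /andP [_ /eqP ->].
rewrite (eq_bigl (mem (rotset w))); last by move=> v; rewrite /= rotset_class.
rewrite sumr_const card_rotset //.
by move: nw; rewrite necklace_wordE => /and5P [].
Qed.

(* [pick] selects some rotation of [w]: any rotation-invariant quantity can be
   computed on [w] itself. *)
Lemma pick_rotset p (w : p.-tuple T) : necklace_word w ->
  exists2 v : p.-tuple T, [pick v in rotset w] = Some v & perm_eq v w.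
Proof.
move=> nw; have p0 : (0 < p)%N by case/andP: nw.
case: pickP => [v vw|/(_ w)]; last by rewrite mem_rotset.
by exists v => //; case/imsetP: vw => i _ ->; rewrite perm_rot.
Qed.

End Rotations.

(** * The generating function of ornaments *)

Section Weights.
Variables (l N : nat) (R : comNzRingType) (phi : {rmorphism {mpoly int[N]} -> R}) (s t : R).
Local Notation T := (Letter l N).

Definition letter_stat (z : T) : nat := l * lbar z + lcol z.

(** Invalid letters get weight 0, so sums over words may range over all letters. *)
Definition letter_wt (z : T) : R :=
  if valid_letter z then
    phi 'X_(labs z) * t ^+ letter_stat z * s ^+ (l - letter_stat z)
  else 0.

Definition necklace_wt p (S : {set p.-tuple T}) : R :=
  phi (neck_wt S) * t ^+ neck_stat S * s ^+ (l * p - neck_stat S).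

Lemma letter_stat_le z : valid_letter z -> (letter_stat z <= l)%N.
Proof.
rewrite /valid_letter /letter_stat; case: lbar => /= [/eqP ->|_].
  by rewrite muln1 addn0.
by rewrite muln0 add0n ltnW // ltn_ord.
Qed.

Lemma prod_letter_wt (w : seq T) : all (@valid_letter l N) w ->
  (\sum_(z <- w) letter_stat z <= l * size w)%N /\
  \prod_(z <- w) letter_wt z =
    phi (\prod_(z <- w) 'X_(labs z)) * t ^+ (\sum_(z <- w) letter_stat z)
      * s ^+ (l * size w - \sum_(z <- w) letter_stat z).
Proof.
elim: w => [|z w IH] /=; first by rewrite !big_nil rmorph1 muln0 !expr0 !mulr1.
case/andP => vz /IH [le E]; have lz := letter_stat_le vz.
rewrite !big_cons mulnS leq_add // E /letter_wt vz; split=> //.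
rewrite rmorphM exprD.
have -> : (l + l * size w - (letter_stat z + \sum_(j <- w) letter_stat j) =
  (l - letter_stat z) + (l * size w - \sum_(j <- w) letter_stat j))%N by lia.
by rewrite exprD; ring.
Qed.

Lemma necklace_wt_rotset p (w : p.-tuple T) : necklace_word w ->
  (neck_stat (rotset w) <= l * p)%N /\
  necklace_wt (rotset w) = \prod_(z <- w) letter_wt z.
Proof.
move=> nw; have [v Ev pvw] := pick_rotset nw.
have vw : all (@valid_letter l N) w by move: nw; rewrite necklace_wordE => /and5P [].
have [le ->] := prod_letter_wt vw; rewrite size_tuple in le *.
have Es : neck_stat (rotset w) = (\sum_(z <- w) letter_stat z)%N.
  by rewrite /neck_stat Ev -(perm_big _ pvw) big_tuple.
have Ew : neck_wt (rotset w) = \prod_(z <- w) 'X_(labs z).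
  by rewrite /neck_wt Ev -(perm_big _ pvw) [RHS]big_tuple.
by rewrite /necklace_wt Es Ew.
Qed.

Lemma is_necklace_gt0 p (S : {set p.-tuple T}) : is_necklace S -> (0 < p)%N.
Proof. by case/existsP => w /andP [/andP []]. Qed.

Lemma neck_stat_le p (S : {set p.-tuple T}) : is_necklace S -> (neck_stat S <= l * p)%N.
Proof. by case/existsP => w /andP [/necklace_wt_rotset [] H _ /eqP ->]. Qed.

Definition necklace_prod M : {poly R} :=
  \prod_(0 <= p < M) \prod_(S : {set p.-tuple T} | is_necklace S)
    (1 - necklace_wt S *: 'X^p).

Definition necklace_geom M : {poly R} :=
  \prod_(0 <= p < M) \prod_(S : {set p.-tuple T} | is_necklace S)
    geom M (necklace_wt S) p.

Lemma vanish_necklace_geom M :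
  vanish M (necklace_geom M * necklace_prod M - 1).
Proof.
rewrite -big_split /=; apply: vanish_prod1 => p _.
rewrite -big_split /=; apply: vanish_prod1 => S /is_necklace_gt0 p0.
exact: vanish_geom.
Qed.

Lemma vanish_necklace_prod n M : (n <= M)%N ->
  vanish n (necklace_prod M - necklace_prod n).
Proof.
move=> nM; rewrite /necklace_prod (big_cat_nat (leq0n n) nM) /=.
set A := \prod_(0 <= p < n) _; set B := \prod_(n <= p < M) _.
have -> : A * B - A = A * (B - 1) by ring.
apply: vanishMl; rewrite /B big_nat_cond; apply: vanish_prod1 => p /andP [/andP [np _] _].
apply: vanish_prod1 => S _; rewrite addrAC subrr add0r -mul_polyC; apply: vanishN.
exact: vanish_mulXn.
Qed.

(** Each necklace counted by [orn_j] has one letter, so [orn_j f <= n] and summing over [j] lifts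
    the condition on it. *)
Lemma QnkE n k :
  Qnk l N n k = \sum_(f : {ffun Key l N n -> 'I_n.+1} | orn_valid f && (orn_stat f == k))
    orn_wt f.
Proof.
rewrite /Qnk /Qnkj [RHS](partition_big (fun f => inord (orn_j f) : 'I_n.+1) predT) //=.
apply: eq_bigr => j _; apply: eq_bigl => f; rewrite andbA.
case: (boolP (orn_valid f)) => //= /andP [_ /eqP Ef]; case: (_ == k) => //=.
have le : (orn_j f <= n)%N.
  rewrite /orn_j -[X in (_ <= X)%N]Ef [X in (X <= _)%N]big_mkcond /=; apply: leq_sum => c _.
  by case: andP => // -[/eqP E _]; rewrite leq_pmull // E.
by rewrite -val_eqE /= inordK.
Qed.

(** Homogenised to degree [l * n], so that exchanging [s] and [t] reverses the coefficients. *)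
Definition flag_wt n : R :=
  \sum_(k < (l * n).+1) phi (Qnk l N n k) * t ^+ k * s ^+ (l * n - k).

Lemma prod_ornament n (f : {ffun Key l N n -> 'I_n.+1}) : orn_valid f ->
  (orn_stat f <= l * n)%N /\
  \prod_c necklace_wt (tagged c) ^+ f c =
    phi (orn_wt f) * t ^+ orn_stat f * s ^+ (l * n - orn_stat f).
Proof.
case/andP => /forallP Hf /eqP Ef.
(* The exponents of [s] also add up over the necklaces; as a sum, this avoids truncated
   subtraction. *)
have E : (orn_stat f + \sum_(c : Key l N n) (l * tag c - neck_stat (tagged c)) * f c = l * n)%N.
  rewrite -[X in (l * X)%N]Ef big_distrr -big_split /=; apply: eq_bigr => c _.
  rewrite mulnA -mulnDl; have := Hf c; case: eqP => [->|_ /neck_stat_le H]; first by rewrite !muln0.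
  by rewrite subnKC.
split; first by rewrite -E leq_addr.
rewrite -E addKn rmorph_prod /orn_stat.
rewrite !(big_morph (fun m => t ^+ m) (exprD _) (expr0 _)).
rewrite !(big_morph (fun m => s ^+ m) (exprD _) (expr0 _)) -!big_split /=.
by apply: eq_bigr => c _; rewrite /necklace_wt !exprMn rmorphXn !exprM.
Qed.

(** With [n] letters only necklaces of length at most [n] occur. The truncation thus depends on [n],
    and the coefficients are assembled by [vanish_diag_inverse]. *)
Lemma flag_wtE n : flag_wt n = (necklace_geom n.+1)`_n.
Proof.
have -> : necklace_geom n.+1 =
    \prod_(c : Key l N n | is_necklace (tagged c)) geom n.+1 (necklace_wt (tagged c)) (tag c).
  rewrite /necklace_geom big_mkord.
  rewrite (sig_big_dep (J := fun p : 'I_n.+1 => {set p.-tuple T}) predT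
    (fun p => @is_necklace l N p) (fun p S => geom n.+1 (necklace_wt S) p)).
  by apply: eq_bigl.
rewrite coef_prod_geom [RHS](partition_big
  (fun f : {ffun Key l N n -> 'I_n.+1} => inord (orn_stat f) : 'I_(l * n).+1) predT) //=.
apply: eq_bigr => k _; rewrite QnkE rmorph_sum !mulr_suml.
apply: eq_big => [f|f /andP [vf /eqP <-]]; last by have [_ ->] := prod_ornament vf.
rewrite -/(orn_valid f); case: (boolP (orn_valid f)) => //= /prod_ornament [le _].
by rewrite -[RHS]val_eqE /= inordK.
Qed.

Lemma vanish_flag_series M :
  vanish M ((\poly_(n < M) flag_wt n) * necklace_prod M - 1).
Proof.
apply: (vanish_diag_inverse (F := fun n => necklace_geom n.+1)) => n nM.
  set F := necklace_geom _.
  have -> : F * necklace_prod M - 1 = F * (necklace_prod M - necklace_prod n.+1)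
    + (F * necklace_prod n.+1 - 1) by ring.
  by apply: vanishD; [apply/vanishMl/vanish_necklace_prod|apply: vanish_necklace_geom].
exact: flag_wtE.
Qed.

End Weights.

Lemma eq_walk (R : comNzRingType) (T : finType) (g h : T -> T -> R) k x y :
  g =2 h -> walk g k x y = walk h k x y.
Proof.
move=> E; elim: k x => //= k IH x; apply: eq_bigr => z _.
by rewrite E IH.
Qed.

(** * Logarithmic derivative of the necklace product *)

Section Resummation.
Variables (l N : nat) (R : comNzRingType) (phi : {rmorphism {mpoly int[N]} -> R}) (s t : R).
Hypothesis l_gt0 : (0 < l)%N.
Local Notation T := (Letter l N).
Local Notation xv := (fun u : 'I_N => phi 'X_u).
Local Notation p := (s ^+ l).
Local Notation q := (t ^+ l).
Local Notation wl := (letter_wt phi s t).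
Local Notation ok := (@succ_ok l N).

Definition geom_sum : R := \sum_(m < l) s ^+ (l.-1 - m) * t ^+ m.

Lemma geom_sumE : (s - t) * geom_sum = p - q.
Proof. by rewrite subrXX. Qed.

Definition letter_step (z : T) (v : 'I_N) : R :=
  if (lbar z ==> (v <= labs z)%N) && ((~~ lbar z && (lcol z == 0%N)) ==> (labs z <= v)%N)
  then wl z else 0.

Lemma letter_transfer (u v : 'I_N) :
  \sum_(z : T | labs z == u) letter_step z v = transfer xv s t q geom_sum u v.
Proof.
pose A z := letter_step z v.
rewrite (reindex_onto (fun y : 'I_l * bool => (u, y.1, y.2) : T) (fun z : T => (z.1.2, z.2)));
  last by case=> -[u' m] b /= /eqP <-.
rewrite (eq_bigl predT) => [|[m b]]; last by rewrite /labs /= !eqxx.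
transitivity (\sum_(m < l) \sum_b A (u, m, b)).
  by rewrite pair_bigA; apply: eq_bigr => -[].
(* [C] collects the positive colours, whose letters put no constraint on the next one. *)
pose C := \sum_(m < l | m != Ordinal l_gt0) s ^+ (l - m) * t ^+ m.
have sL : s * geom_sum = p + C.
  rewrite /geom_sum mulr_sumr /C (bigD1 (Ordinal l_gt0)) //= expr0 mulr1 subn0.
  rewrite -exprS prednK //; congr (_ + _); apply: eq_bigr => m _.
  by rewrite mulrA -exprS; congr (_ ^+ _ * _); have := ltn_ord m; lia.
have tL : t * geom_sum = C + q.
  by apply: (addrI (p - q)); rewrite -{1}geom_sumE mulrBl subrK sL; ring.
have AF m : m != Ordinal l_gt0 -> A (u, m, true) + A (u, m, false) =
    xv u * (s ^+ (l - m) * t ^+ m).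
  rewrite -val_eqE /= => /negbTE m0.
  rewrite /A /letter_step /letter_wt /valid_letter /letter_stat /labs /lcol /lbar /=.
  rewrite m0 /= andbT if_same.
  by rewrite add0r muln0 add0n; ring.
rewrite (bigD1 (Ordinal l_gt0)) //= big_bool /=.
rewrite (eq_bigr (fun m : 'I_l => xv u * (s ^+ (l - m) * t ^+ m))); last first.
  by move=> m m0; rewrite big_bool /= AF.
rewrite -mulr_sumr -/C /transfer sL tL /A /letter_step /letter_wt /valid_letter /letter_stat.
rewrite /labs /lcol /lbar /= !andbT muln0 muln1 addn0 subnn subn0 !expr0 !mulr1.
by case: ltngtP => _; rewrite ?eqxx; ring.
Qed.

(** Whether [y] may follow [z] depends on [y] only through its absolute value, so the trace descends
    to absolute values. *)
Lemma trace_letters d : (0 < d)%N ->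
  \sum_(w : d.-tuple T | cycle ok w) \prod_(z <- w) wl z =
  \sum_u walk (transfer xv s t q geom_sum) d u u.
Proof.
move=> d0; rewrite sum_cycle //; case: d d0 => // d _.
rewrite -[LHS]/(\sum_z walk (fun x y => letter_step x (labs y)) d.+1 z z) walk_trace_proj.
by apply: eq_bigr => u _; apply: eq_walk => a b; rewrite letter_transfer.
Qed.

Lemma sum_barred (F : T -> R) :
  \sum_(z : T | valid_letter z && lbar z) F z = \sum_u F (u, Ordinal l_gt0, true).
Proof.
rewrite (reindex_onto (fun u => (u, Ordinal l_gt0, true) : T) (fun z : T => labs z)) /=.
  by apply: eq_bigl => u; rewrite /labs /= eqxx.
case=> -[u m] b; rewrite /valid_letter /lbar /lcol /labs /= => /andP [vz b1].
by move: vz; rewrite b1 /= => /eqP m0; congr (_, _, _); apply: val_inj.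
Qed.

Lemma prod_letter_wt0 (w : seq T) :
  ~~ all (@valid_letter l N) w -> \prod_(z <- w) wl z = 0.
Proof.
elim: w => //= z w IH; rewrite negb_and big_cons => /orP [/negbTE nv|/IH ->].
  by rewrite /letter_wt nv mul0r.
by rewrite mulr0.
Qed.

(* The two sides differ by the words consisting of a single barred letter. *)
Lemma sum_necklace_words k e : (0 < k)%N -> (0 < e)%N ->
  \sum_(w : k.-tuple T | primitive w && cycle ok w) (\prod_(z <- w) wl z) ^+ e =
  \sum_(w : k.-tuple T | necklace_word w) (\prod_(z <- w) wl z) ^+ e
    + if k == 1%N then \sum_u (q * xv u) ^+ e else 0.
Proof.
move=> k0 e0; rewrite (bigID (@necklace_word l N k)) /=; congr (_ + _).
  apply: eq_bigl => w; rewrite necklace_wordE k0 /=.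
  by case: (primitive w); case: (cycle _ _); rewrite ?andbF ?andbT.
have z0 (w : seq T) : ~~ all (@valid_letter l N) w -> (\prod_(z <- w) wl z) ^+ e = 0.
  by move/prod_letter_wt0 ->; rewrite expr0n eqn0Ngt e0.
case: eqP => [k1|/eqP k1]; last first.
  (* Beyond length 1, such a word fails to be a necklace word only through an invalid letter, hence
     has weight 0. *)
  apply: big1 => w /andP [/andP [pw cw]]; rewrite necklace_wordE k0 pw cw k1 /= !andbT.
  exact: z0.
move: k0; rewrite {k}k1 => _; rewrite sum_tuple_cons.
have -> : \sum_u (q * xv u) ^+ e = \sum_(z : T | valid_letter z && lbar z) wl z ^+ e.
  rewrite sum_barred; apply: eq_bigr => u _; congr (_ ^+ _).
  rewrite /letter_wt /valid_letter /letter_stat /lbar /lcol /labs /= muln1 addn0 subnn expr0.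
  by ring.
rewrite [RHS]big_mkcond; apply: eq_bigr => z _.
rewrite big_mkcond (big_pred1 [tuple]) => [|v]; last by apply/esym/eqP; apply: tuple0.
have pz : primitive [:: z].
  apply/negP => /existsP [d /and3P [d1 /= ]].
  by rewrite dvdn1 => /eqP dE; rewrite dE in d1.
rewrite necklace_wordE /= pz /succ_ok !leqnn !implybT /= !andbT big_seq1.
case: (boolP (valid_letter z)) => vz /=; last first.
  by have := z0 [:: z]; rewrite /= big_seq1 andbT => ->; rewrite ?if_same.
by case: (lbar z).
Qed.

(** A necklace of length [k] dividing [d] contributes [k] times its weight to the power [d / k], one
    term per rotation. With the barred one-letter words these are the powers of all primitive
    admissible words, that is, all closed words. *)
Lemma coef_necklace_logder M d : (0 < d < M)%N ->
  (\sum_(0 <= k < M) \sum_(S : {set k.-tuple T} | is_necklace S)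
     logder M (necklace_wt phi s t S) k)`_d
  + \sum_u (q * xv u) ^+ d
  = \sum_(w : d.-tuple T | cycle ok w) \prod_(z <- w) wl z.
Proof.
case/andP => d0 dM; pose G k := \sum_(w : k.-tuple T | necklace_word w)
  (\prod_(z <- w) wl z) ^+ (d %/ k).
have -> : (\sum_(0 <= k < M) \sum_(S : {set k.-tuple T} | is_necklace S)
    logder M (necklace_wt phi s t S) k)`_d = \sum_(0 <= k < M | (k %| d)%N) G k.
  rewrite coef_sum [RHS]big_mkcond; apply: eq_bigr => k _; rewrite coef_sum.
  rewrite (eq_bigr (fun S : {set k.-tuple T} =>
    if (k %| d)%N then necklace_wt phi s t S ^+ (d %/ k) *+ k else 0)); last first.
    by move=> S /is_necklace_gt0 k0; rewrite coef_logder // d0.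
  case: ifP => kd; last by rewrite big1.
  rewrite (@sum_necklaces l N _ k (fun S => necklace_wt phi s t S ^+ (d %/ k))).
  by apply: eq_bigr => w nw; have [_ ->] := necklace_wt_rotset phi s t nw.
have large : \sum_(d.+1 <= k < M | (k %| d)%N) G k = 0.
  rewrite big_nat_cond big_pred0 // => k.
  by apply/negP => /andP [/andP [dk _] /(dvdn_leq d0)]; rewrite leqNgt dk.
rewrite (big_cat_nat (leq0n d.+1)) //= large addr0 sum_primitive_roots // big_mkord.
rewrite [RHS](eq_bigr (fun k : 'I_d.+1 => G k + if k == 1%N :> nat then
   \sum_u (q * xv u) ^+ d else 0)).
  rewrite big_split /=; congr (_ + _).
  rewrite -big_mkcondr (big_pred1 (inord 1)) // => k.
  rewrite -[RHS]val_eqE /= inordK //; case: eqP => [->|]; by rewrite ?dvd1n ?andbF.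
move=> k kd; have k0 := dvdn_gt0 d0 kd.
have e0 : (0 < d %/ k)%N by rewrite divn_gt0 // dvdn_leq.
rewrite sum_necklace_words //; congr (_ + _).
by case: (k =P 1%N :> nat) => // ->; rewrite divn1.
Qed.

Hypothesis tf : forall n (x : R), (0 < n)%N -> x *+ n = 0 -> x = 0.

Local Notation NP := (necklace_prod l phi s t).
Local Notation Eu := (euler xv).
Local Notation De := (Delta xv s t p q).

(** Both sides solve [X Y' + Y W = 0] with the same constant coefficient, so [vanish_ode] applies to
    their difference. *)
Lemma vanish_Delta_factor M : vanish M (De - (s - t) *: (NP M * Eu q)).
Proof.
(* For [M = 0] the truncated [wseries] is 0, so its constant coefficient would not be 1. *)
have [->|M0] := posnP M; first by [].
pose W := \sum_(u < N) (wseries xv s t q geom_sum M u u - 1).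
have HD : vanish M ('X * De^`() + De * W) by apply/vanish_deriv_Delta/geom_sumE.
pose SE := \sum_(u < N) logder M (q * xv u) 1.
have HE : vanish M ('X * (Eu q)^`() + Eu q * SE) by apply: vanish_logder.
pose SN := \sum_(0 <= k < M) \sum_(S : {set k.-tuple T} | is_necklace S)
     logder M (necklace_wt phi s t S) k.
have HN : vanish M ('X * (NP M)^`() + NP M * SN).
  have := @vanish_logder R M {k : 'I_M & {set k.-tuple T}} (index_enum _)
    (fun c => is_necklace (tagged c)) (fun c => necklace_wt phi s t (tagged c)) (fun c => tag c)
    (fun c => @is_necklace_gt0 l N (tag c) (tagged c)).
  rewrite -(sig_big_dep (J := fun k : 'I_M => {set k.-tuple T}) predT
    (fun k => @is_necklace l N k) (fun k S => 1 - necklace_wt phi s t S *: 'X^k)).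
  rewrite -(sig_big_dep (J := fun k : 'I_M => {set k.-tuple T}) predT
    (fun k => @is_necklace l N k) (fun k S => logder M (necklace_wt phi s t S) k)).
  by rewrite /necklace_prod /SN !big_mkord.
(* The trace series is the sum of the logarithmic derivatives of the two factors. *)
have HW : vanish M (SN + SE - W).
  move=> d dM; rewrite coefB coefD /SE /W !coef_sum.
  case: (posnP d) => [d0|d0].
    rewrite d0 [X in X + _ - _]big1 => [|k _]; last first.
      rewrite coef_sum big1 // => S /is_necklace_gt0 k0.
      by rewrite coef_logder.
    rewrite !big1 ?addr0 ?subr0 // => u _; last by rewrite coef_logder.
    by rewrite coefB coef_poly M0 /= eqxx coefC subrr.
  apply/eqP; rewrite subr_eq0; apply/eqP.
  rewrite (eq_bigr (fun u : 'I_N => (q * xv u) ^+ d)) => [|u _]; last first.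
    by rewrite coef_logder // d0 dvd1n divn1 mulr1n.
  rewrite -coef_sum coef_necklace_logder ?d0 // trace_letters //; apply: eq_bigr => u _.
  by rewrite coefB coef_poly dM coefC (gtn_eqF d0) subr0.
apply: (vanish_ode (T := W)) => //.
- rewrite coef_sum big1 // => u _.
  by rewrite coefB coef_poly M0 /= eqxx coefC subrr.
(* Both constant coefficients equal [s - t]. *)
- suff H : vanish 1 (De - (s - t) *: (NP M * Eu q)) by apply: H.
  have vE c : vanish 1 (Eu c - 1).
    apply: vanish_prod1 => u _; rewrite addrAC subrr add0r -mul_polyC; apply: vanishN.
    exact: vanish_mulXn.
  have vN : vanish 1 (NP M - 1).
    apply: vanish_prod1 => k _; apply: vanish_prod1 => S /is_necklace_gt0 k0.
    rewrite addrAC subrr add0r -mul_polyC; apply: vanishN; exact: vanish_mulXn.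
  have -> : De - (s - t) *: (NP M * Eu q) = s%:P * (Eu p - 1) + (- t%:P) * (Eu q - 1)
     + (- (s - t)%:P * Eu q) * (NP M - 1) + (- (s - t)%:P) * (Eu q - 1).
    by rewrite /Delta -!mul_polyC polyCB; ring.
  by do 3?[apply: vanishD]; apply: vanishMl.
rewrite derivB derivZ derivM.
have -> : 'X * (De^`() - (s - t) *: ((NP M)^`() * Eu q + NP M * (Eu q)^`()))
    + (De - (s - t) *: (NP M * Eu q)) * W =
  ('X * De^`() + De * W) + (- (s - t)%:P * Eu q) * ('X * (NP M)^`() + NP M * SN)
  + (- (s - t)%:P * NP M) * ('X * (Eu q)^`() + Eu q * SE)
  + ((s - t)%:P * NP M * Eu q) * (SN + SE - W).
  by rewrite -!mul_polyC; ring.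
by do 3?[apply: vanishD] => //; apply: vanishMl.
Qed.

End Resummation.

(** * The symmetry *)

Section CompleteSymmetric.
Variables (N : nat) (R : comNzRingType) (phi : {rmorphism {mpoly int[N]} -> R}).

Lemma hsymE n : hsym N n =
  \sum_(f : {ffun 'I_N -> 'I_n.+1} | (\sum_u f u == n)%N) \prod_u 'X_u ^+ f u.
Proof.
(* The default [bm0] is taken only when the exponents sum to more than [n], which the summation
   condition excludes. *)
pose h (f : {ffun 'I_N -> 'I_n.+1}) : 'X_{1..N < n.+1} :=
  insubd bm0 [multinom (f u : nat) | u < N].
pose h' (m : 'X_{1..N < n.+1}) : {ffun 'I_N -> 'I_n.+1} := [ffun u => inord (val m u)].
have le (m : 'X_{1..N < n.+1}) u : (val m u < n.+1)%N.
  apply: leq_ltn_trans (bmdeg m); rewrite mdegE (bigD1 u) //=; apply: leq_addr.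
have sum_h' m : (\sum_u h' m u)%N = mdeg (val m).
  by rewrite mdegE; apply: eq_bigr => u _; rewrite ffunE inordK.
have hE (f : {ffun 'I_N -> 'I_n.+1}) : (\sum_u f u == n)%N ->
    val (h f) = [multinom (f u : nat) | u < N].
  move=> /eqP fn; rewrite /h insubdK // -topredE /= mdegE.
  by rewrite (eq_bigr (fun u => f u : nat)) ?fn // => u _; rewrite mnmE.
rewrite /hsym (reindex_onto h h') => [|m mn]; last first.
  by apply: val_inj; rewrite hE ?sum_h' //; apply/mnmP => u; rewrite mnmE ffunE inordK.
apply: eq_big => [f|f /andP [mn /eqP E]].
  apply/andP/idP => [[mn /eqP <-]|fn]; first by rewrite sum_h'.
  rewrite hE // mdegE (eq_bigr (fun u => f u : nat)) => [|u _]; last by rewrite mnmE.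
  split=> //; apply/eqP/ffunP => u; rewrite ffunE hE // mnmE.
  by rewrite inord_val.
rewrite mpolyXE_id; apply: eq_bigr => u _.
by rewrite hE ?mnmE // -E sum_h'.
Qed.

Lemma vanish_hsym_series M (c : R) :
  vanish M ((\poly_(n < M) (phi (hsym N n) * c ^+ n)) * euler (fun u => phi 'X_u) c - 1).
Proof.
apply: (vanish_diag_inverse (F := fun n => \prod_(u < N) geom n.+1 (c * phi 'X_u) 1)) => n nM.
  by rewrite -big_split /=; apply: vanish_prod1 => u _; apply: vanish_geom.
rewrite coef_prod_geom hsymE rmorph_sum mulr_suml; apply: eq_big => [f|f /eqP fn].
  have E1 : (\sum_(u < N) 1 * f u = \sum_u f u)%N by apply: eq_bigr => u _; rewrite mul1n.
  rewrite /= E1.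
  by case: (_ == n); rewrite ?andbF // andbT; apply/esym/forallP => u; rewrite implybT.
have -> : c ^+ n = \prod_u c ^+ f u.
  by rewrite -[in LHS]fn (big_morph (fun m => c ^+ m) (exprD _) (expr0 _)).
rewrite rmorph_prod -big_split /=.
by apply: eq_bigr => u _; rewrite rmorphXn exprMn mulrC.
Qed.

End CompleteSymmetric.

Section Symmetry.
Variables (l N : nat) (R : idomainType) (phi : {rmorphism {mpoly int[N]} -> R}).
Hypothesis l_gt0 : (0 < l)%N.
Hypothesis tf : forall n (x : R), (0 < n)%N -> x *+ n = 0 -> x = 0.
Variables (M : nat) (s t : R).
Hypothesis st : s - t != 0.
Local Notation p := (s ^+ l).
Local Notation q := (t ^+ l).
Local Notation H c := (\poly_(n < M) (phi (hsym N n) * c ^+ n)).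
Local Notation QQ a b := (\poly_(n < M) flag_wt l phi a b n).
Local Notation Eu := (euler (fun u : 'I_N => phi 'X_u)).

(** Combines [Q NP = 1] with [D = (a - b) NP E_(b^l)] to eliminate the necklace product [NP]. *)
Lemma vanish_flag_Delta (a b : R) :
  vanish M (QQ a b * (a *: Eu (a ^+ l) - b *: Eu (b ^+ l)) - (a - b) *: Eu (b ^+ l)).
Proof.
have HQ := @vanish_flag_series l N R phi a b M.
have HD := @vanish_Delta_factor l N R phi a b l_gt0 tf M.
rewrite /Delta in HD; set D := a *: Eu (a ^+ l) - b *: Eu (b ^+ l) in HD *.
set NP := necklace_prod _ _ _ _ _ in HQ HD.
set Q := QQ a b in HQ *.
have -> : Q * D - (a - b) *: Eu (b ^+ l) =
  Q * (D - (a - b) *: (NP * Eu (b ^+ l))) + ((a - b)%:P * Eu (b ^+ l)) * (Q * NP - 1).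
  by rewrite -!mul_polyC; ring.
by apply: vanishD; apply: vanishMl.
Qed.

(** In place of division, the denominators are cleared and then removed by multiplying with known
    inverses; this leaves a factor [s - t], cancelled in the domain [R]. *)
Lemma vanish_flag_symmetry :
  vanish M (s%:P ^+ 2 * (H q * (QQ t s - 1)) - t%:P ^+ 2 * (H p * (QQ s t - 1))
    - s%:P * t%:P * (H p - H q)).
Proof.
set X := _ - _.
have a1 := @vanish_hsym_series N R phi M p; have a2 := @vanish_hsym_series N R phi M q.
have a3 := vanish_flag_Delta s t; have a4 := vanish_flag_Delta t s.
rewrite -!mul_polyC !polyCB in a3 a4.
set D := s%:P * Eu p - t%:P * Eu q in a3.
have V : vanish M (D * Eu p * Eu q * X).
  move: a1 a2 a3 a4; rewrite /X /D.
  set Hp := H p; set Hq := H q; set Q := QQ s t; set Q' := QQ t s.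
  set Ep := Eu p; set Eq := Eu q; set S := s%:P; set T := t%:P => a1 a2 a3 a4.
  have -> : (S * Ep - T * Eq) * Ep * Eq *
      (S ^+ 2 * (Hq * (Q' - 1)) - T ^+ 2 * (Hp * (Q - 1)) - S * T * (Hp - Hq)) =
    (S ^+ 2 * Ep * (Q' - 1) * (S * Ep - T * Eq) + S * T * (S * Ep - T * Eq) * Ep) * (Hq * Eq - 1)
    + (- S ^+ 2 * Ep) * (Q' * (T * Eq - S * Ep) - (T - S) * Ep)
    + (- (T ^+ 2 * Eq * (Q - 1) * (S * Ep - T * Eq)) - S * T * (S * Ep - T * Eq) * Eq)
       * (Hp * Ep - 1)
    + (- T ^+ 2 * Eq) * (Q * (S * Ep - T * Eq) - (S - T) * Eq) by ring.
  by do 3?[apply: vanishD]; apply: vanishMl.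
(* [Q D] is [(s - t) E_q], and the [H] series invert the [E] series; the second [Hq] absorbs the
   extra [Eq]. *)
have W : vanish M ((s - t)%:P * X).
  move: a1 a2 a3 V; clearbody X D; rewrite polyCB.
  set Hp := H p; set Hq := H q; set Q := QQ s t.
  set Ep := Eu p; set Eq := Eu q; set S := s%:P; set T := t%:P => a1 a2 a3 V.
  have -> : (S - T) * X = (Q * Hp * Hq * Hq) * (D * Ep * Eq * X)
    + (- (Hq * Hp * Ep * Hq * Eq * X)) * (Q * D - (S - T) * Eq)
    + (- (S - T) * X * (Hq * Eq) * (Hq * Eq)) * (Hp * Ep - 1)
    + (- (S - T) * X * (Hq * Eq + 1)) * (Hq * Eq - 1) by ring.
  by do 3?[apply: vanishD]; apply: vanishMl.
move=> i /W; rewrite coefCM => /eqP; rewrite mulf_eq0 (negbTE st) /= => /eqP.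
exact.
Qed.

End Symmetry.

(** * Extraction of coefficients *)

Lemma Qnk_gt l N n k : (l * n < k)%N -> Qnk l N n k = 0.
Proof.
move=> lt; rewrite QnkE big_pred0 // => f; apply/negP => /andP [vf /eqP Ef].
have [le _] := prod_ornament (R := {mpoly int[N]}) idfun 0 0 vf.
by rewrite -Ef ltnNge le in lt.
Qed.

Lemma flag_wt0 l N (R : comNzRingType) (phi : {rmorphism {mpoly int[N]} -> R}) s t :
  flag_wt l phi s t 0 = 1.
Proof.
rewrite flag_wtE /necklace_geom big_nat1 big_pred0 ?coef1 // => S.
by case: (boolP (is_necklace S)) => // /is_necklace_gt0.
Qed.

(** Subtracting [1 = flag_wt 0] removes the term [i = n], whence the range [i < n]. *)
Lemma coef_hsym_flag l N (R : comNzRingType) (phi : {rmorphism {mpoly int[N]} -> R}) c s t n :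
  ((\poly_(i < n.+1) (phi (hsym N i) * c ^+ i)) * (\poly_(i < n.+1) flag_wt l phi s t i - 1))`_n
  = \sum_(i < n) phi (hsym N i) * c ^+ i * flag_wt l phi s t (n - i).
Proof.
rewrite coefM big_ord_recr /= subnn coefB [X in _ * (X - _)]coef_poly flag_wt0 coef1 subrr.
rewrite mulr0 addr0; apply: eq_bigr => i _.
rewrite coef_poly (ltn_trans (ltn_ord i)) // coefB coef_poly ltnS leq_subr coef1.
by rewrite subn_eq0 leqNgt ltn_ord subr0.
Qed.

Lemma coef_flag_wt_X l N n e :
  (flag_wt l (polyC : {rmorphism {mpoly int[N]} -> _}) 1 'X n)`_e = Qnk l N n e.
Proof.
rewrite /flag_wt coef_sum.
under eq_bigr => k _ do rewrite expr1n mulr1 coefCM coefXn.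
case: (ltnP e (l * n).+1) => he.
  rewrite (bigD1 (Ordinal he)) //= eqxx mulr1 big1 ?addr0 // => k.
  by rewrite -val_eqE /= eq_sym => /negbTE ->; rewrite mulr0.
rewrite Qnk_gt // big1 // => k _.
by rewrite gtn_eqF ?mulr0 // (leq_trans _ he).
Qed.

(** At [s = X], [t = 1] the index [k] sits in degree [l * n - k]. If [e < j] then [k > l * n] and
    both sides vanish. *)
Lemma coef_flag_wt_rev l N n j e k : (j + l * n = e + k)%N ->
  ('X^j * flag_wt l (polyC : {rmorphism {mpoly int[N]} -> _}) 'X 1 n)`_e = Qnk l N n k.
Proof.
move=> E; rewrite coefXnM; case: ltnP => [ej|je]; first by rewrite Qnk_gt //; lia.
rewrite /flag_wt coef_sum.
have kl : (k < (l * n).+1)%N by lia.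
rewrite (bigD1 (Ordinal kl)) //= expr1n mulr1 coefCM coefXn.
rewrite (_ : (e - j == l * n - k)%N); last by apply/eqP; lia.
rewrite mulr1 big1 ?addr0 // => k' nk; rewrite expr1n mulr1 coefCM coefXn.
rewrite (_ : (e - j == l * n - k')%N = false) ?mulr0 //.
apply: contraNF nk => /eqP H; apply/eqP/val_inj => /=.
by have := ltn_ord k'; lia.
Qed.

Theorem theorem1p2 (l n a b : nat) :
  (0 < l)%N -> (1 <= n)%N -> (1 <= a)%N -> (1 <= b)%N -> (a + b)%N = (l * n)%N ->
  forall N : nat,
    \sum_(i < n) hsym N i * Qnk l N (n - i) (a - 1)
    = \sum_(i < n) hsym N i * Qnk l N (n - i) (b - 1).
Proof.
(* The variable of [R] plays the role of [t], with [s = 1]; the series variable [z] lies above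
   it. *)
move=> l0 n0 a0 b0 ab N; pose R : idomainType := {poly {mpoly int[N]}}.
pose phi : {rmorphism {mpoly int[N]} -> R} := polyC.
have tf k (x : R) : (0 < k)%N -> x *+ k = 0 -> x = 0.
  move=> k0 H; apply/polyP => i; rewrite coef0; apply/mpolyP => m; rewrite mcoeff0.
  have /eqP := congr1 (fun y : R => (y`_i)@_m) H.
  rewrite coefMn mcoeffMn coef0 mcoeff0 Num.Theory.mulrn_eq0 eqn0Ngt k0 /=.
  by move/eqP.
have X1 : (1 : R) - 'X != 0.
  apply/eqP => /(congr1 (fun y : R => y`_0)).
  by rewrite coefB coef1 coefX coef0 /= subr0 => /eqP; rewrite oner_eq0.
have Ea : (\sum_(i < n) phi (hsym N i) * 1 ^+ i * flag_wt l phi 1 'X (n - i))`_(a - 1)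
    = \sum_(i < n) hsym N i * Qnk l N (n - i) (a - 1).
  rewrite coef_sum; apply: eq_bigr => i _.
  by rewrite expr1n mulr1 coefCM coef_flag_wt_X.
(* The power of [q = t^l] compensates the lower degree: [l i + l (n - i) = l n = (a + 1) + (b -
   1)]. *)
have Eb : (\sum_(i < n) phi (hsym N i) * ('X^l : R) ^+ i * flag_wt l phi 'X 1 (n - i))`_a.+1
    = \sum_(i < n) hsym N i * Qnk l N (n - i) (b - 1).
  rewrite coef_sum; apply: eq_bigr => i _.
  rewrite -mulrA coefCM -exprM (@coef_flag_wt_rev l N (n - i) (l * i) a.+1 (b - 1)) //.
  by rewrite -mulnDr subnKC ?(ltnW (ltn_ord i)) // -ab; lia.
have := vanish_flag_symmetry phi l0 tf X1 (ltnSn n).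
rewrite !coefB -!(@polyC_exp R) -polyCM !coefCM coefB !coef_hsym_flag !coef_poly ltnSn.
rewrite !expr1n !mul1r mulr1 => /(congr1 (fun y : R => y`_a.+1)).
(* The factor [t^2] lowers the degree [a + 1] to [a - 1]. *)
rewrite !coefB coef0 Eb coefXnM ltnS ltnNge a0 /= subSS Ea.
rewrite coefXM /= coefB coefC (gtn_eqF a0) sub0r coefCM -exprM coefXn.
(* The remaining terms live in degrees 1 and [l n + 1] of [t]; here [a < l n] because [b >= 1]. *)
rewrite (_ : (a == l * n)%N = false) ?mulr0 ?oppr0 ?subr0; last by apply/eqP; lia.
by rewrite addr0 => /eqP; rewrite subr_eq0 eq_sym => /eqP.
Qed.
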